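(* Let $H:\mathbb{R}^{2m}\to\mathbb{R}$ be smooth, let $\bar\nabla H$ be the coordinate increment discrete gradient of $H$, and let $\bar y\in\mathbb{R}^{2m}$. The following modification of the coordinate increment discrete gradient scheme is locally exact at $\bar y$: $$y_{n+1}-y_n=\theta_n\,S\,\bar\nabla H(y_n,y_{n+1}),\qquad \theta_n=2\left(SR+F'\coth\frac{h_nF'}{2}\right)^{-1},$$ where $F'=S\,H_{yy}$ and $R$ is the skew-symmetric $2m\times2m$ matrix with entries $R_{jk}=H_{y^jy^k}$ for $j>k$, $R_{jj}=0$, and $R_{jk}=-H_{y^jy^k}$ for $j<k$; $F'$ and $R$ are evaluated at $y=\bar y$, and $h_n>0$ is sufficiently small that $\theta_n$ is defined.
   Context: Hamiltonian system: $y=(x^1,\dots,x^m,p^1,\dots,p^m)^T$, $\dot x^k=\partial H/\partial p^k$, $\dot p^k=-\partial H/\partial x^k$, i.e. $\dot y=F(y)$ with $F=SH_y$, $S=\begin{pmatrix}0&I\\-I&0\end{pmatrix}$, $H_y$ the gradient (column vector), $H_{yy}$ the Hessian of $H$, $H_{y^jy^k}=\partial^2H/\partial y^j\partial y^k$; $F'=SH_{yy}$ is the Jacobi matrix of $F$. The expression $F'\coth\frac{h_nF'}{2}$ is understood as $g(F')$ with $g(z)=z\coth\frac{h_nz}{2}$, $g(0)=2/h_n$ (analytic at $0$). Coordinate increment discrete gradient: $\bar\nabla H=\left(\frac{\Delta H}{\Delta y^1},\dots,\frac{\Delta H}{\Delta y^{2m}}\right)$ (treated as a column vector), $$\frac{\Delta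 H}{\Delta y^j}=\frac{H(y_{n+1}^1,\dots,y_{n+1}^{j},y_n^{j+1},\dots,y_n^{2m})-H(y_{n+1}^1,\dots,y_{n+1}^{j-1},y_n^{j},\dots,y_n^{2m})}{y_{n+1}^j-y_n^j},$$ with the limit value (partial derivative $\partial H/\partial y^j$ at the corresponding point) taken when $y_{n+1}^j=y_n^j$. The unmodified scheme is $y_{n+1}-y_n=h_nS\,\bar\nabla H$. Local exactness at $\bar y$: substitute $y_n=\bar y+\nu_n$, $y_{n+1}=\bar y+\nu_{n+1}$ into the scheme (with $\bar y$, hence $\theta_n$, held fixed) and keep only terms of order at most one in $(\nu_n,\nu_{n+1})$; the scheme is locally exact at $\bar y$ if the resulting linear difference equation, solved for $\nu_{n+1}$, is identical with $\nu_{n+1}=e^{h_nF'}\nu_n+h_n\varphi_1(h_nF')F$ ($F,F'$ evaluated at $\bar y$, $\varphi_1(z)=(e^z-1)/z$, $\varphi_1(0)=1$), which is the exact discretization of the linearized equation $\dot\nu=F'\nu+F$. *)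

(* Defs.v *)
From HB Require Import structures.
From mathcomp Require Import all_boot all_order all_algebra.
From mathcomp Require Import complex.
From mathcomp Require Import all_classical all_reals all_analysis.

Set Implicit Arguments.
Unset Strict Implicit.
Unset Printing Implicit Defensive.

Import Order.TTheory GRing.Theory Num.Theory.
Import numFieldNormedType.Exports.

Local Open Scope classical_set_scope.
Local Open Scope ring_scope.
Local Open Scope complex_scope.

Section ComplexFunctions.
Variable R : realType.

Definition cexp (z : R[i]) : R[i] :=
  let: a +i* b := z in (expR a * cos b) +i* (expR a * sin b).

Definition ccosh (z : R[i]) : R[i] := (cexp z + cexp (- z)) / 2.

Definition csinh (z : R[i]) : R[i] := (cexp z - cexp (- z)) / 2.

(* Takes the junk value 0 at its poles, the zeros of csinh. *)
Definition ccoth (z : R[i]) : R[i] := ccosh z / csinh z.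

Definition phi1 (z : R[i]) : R[i] :=
  if z == 0 then 1 else (cexp z - 1) / z.

Definition zcoth (h : R) (z : R[i]) : R[i] :=
  if z == 0 then 2 / h%:C else z * ccoth (h%:C * z / 2).

End ComplexFunctions.

(* The matrix function f(A) of a real matrix A, by Hermite interpolation on the
   complex spectrum (Higham, Functions of Matrices, Definition 1.4).  Using the
   multiplicities in the characteristic polynomial rather than in the minimal
   one gives the same matrix when f is holomorphic at the eigenvalues of A.
   The interpolating polynomial can be taken real, so that f(A) is real, when
   moreover f commutes with complex conjugation. *)
Section MatrixFunctions.
Variables (R : realType) (n : nat).

Definition cplxmx (A : 'M[R]_n) : 'M[R[i]]_n := map_mx (real_complex R) A.

Definition interpolates (f : R[i] -> R[i]) (A : 'M[R]_n) (p : {poly R}) : Prop :=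
  forall (lambda : R[i]) (j : nat),
    (j < mup lambda (char_poly (cplxmx A)))%N ->
    (map_poly (real_complex R) p)^`(j).[lambda] =
    derive1n j (f : R[i] -> (R[i])^o) lambda.

(* p(A) does not depend on the choice of the interpolating polynomial p. *)
Definition mxfun (f : R[i] -> R[i]) (A : 'M[R]_n) : 'M[R]_n :=
  xget 0 [set B : 'M[R]_n | exists2 p : {poly R},
    interpolates f A p & B = \sum_(k < size p) p`_k *: A ^+ k].

End MatrixFunctions.

Section Calculus.
Variables (R : realType) (n : nat).
Implicit Types (H : 'cV[R]_n -> R) (y : 'cV[R]_n).

Definition basis_vec (j : 'I_n) : 'cV[R]_n := delta_mx j 0.

Definition partial (j : 'I_n) H : 'cV[R]_n -> R := fun y => 'D_(basis_vec j) H y.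

(* C^oo: partial derivatives of all orders exist and are differentiable. *)
Definition smooth H : Prop :=
  forall (js : seq 'I_n) y, differentiable (foldr partial H js) y.

Definition grad H y : 'cV[R]_n := \col_j partial j H y.

Definition hess H y : 'M[R]_n := \matrix_(j, k) partial k (partial j H) y.

(* The point (y1^1, ..., y1^k, y0^(k+1), ..., y0^n). *)
Definition stair y0 y1 (k : nat) : 'cV[R]_n :=
  \col_i (if (i < k)%N then y1 i 0 else y0 i 0).

Definition discrete_grad H y0 y1 : 'cV[R]_n :=
  \col_j (if y1 j 0 == y0 j 0 then partial j H (stair y0 y1 j)
          else (H (stair y0 y1 j.+1) - H (stair y0 y1 j)) / (y1 j 0 - y0 j 0)).

Definition skew_hess H y : 'M[R]_n :=
  \matrix_(j, k) (if (k < j)%N then hess H y j k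
                  else if (j < k)%N then - hess H y j k else 0).

(* A one-step scheme is given by its residual: the scheme is the equation
   res (y_n, y_(n+1)) = 0.  F is the value at ybar of the vector field and DF
   that of its Jacobi matrix. *)
Definition locally_exact (F : 'cV[R]_n) (DF : 'M[R]_n) (h : R)
    (res : 'cV[R]_n * 'cV[R]_n -> 'cV[R]_n) (ybar : 'cV[R]_n) : Prop :=
  differentiable res (ybar, ybar) /\
  forall nu0 nu1 : 'cV[R]_n,
    res (ybar, ybar) + 'd res (ybar, ybar) (nu0, nu1) = 0 <->
    nu1 = mxfun (@cexp R) (h *: DF) *m nu0
          + h *: (mxfun (@phi1 R) (h *: DF) *m F).

End Calculus.

Section Hamiltonian.
Variables (R : realType) (m : nat).
Implicit Types (H : 'cV[R]_(m + m) -> R) (y : 'cV[R]_(m + m)).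

Definition symplmx : 'M[R]_(m + m) := block_mx 0 1%:M (- 1%:M) 0.

Definition hamF H y : 'cV[R]_(m + m) := symplmx *m grad H y.

Definition hamDF H y : 'M[R]_(m + m) := symplmx *m hess H y.

Definition theta_den H (h : R) (ybar : 'cV[R]_(m + m)) : 'M[R]_(m + m) :=
  symplmx *m skew_hess H ybar + mxfun (zcoth h) (hamDF H ybar).

(* theta = 2 (S R + F' coth (h F' / 2))^-1 makes sense at ybar: z coth (h z / 2)
   has no pole at an eigenvalue of F', and the matrix to be inverted is
   invertible. *)
Definition theta_defined H (h : R) (ybar : 'cV[R]_(m + m)) : Prop :=
  (forall lambda : R[i], eigenvalue (cplxmx (hamDF H ybar)) lambda ->
     lambda != 0 -> csinh (h%:C * lambda / 2) != 0) /\
  theta_den H h ybar \in unitmx.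

Definition theta H (h : R) (ybar : 'cV[R]_(m + m)) : 'M[R]_(m + m) :=
  2 *: invmx (theta_den H h ybar).

Definition dg_residual (th : 'M[R]_(m + m)) H
    (y : 'cV[R]_(m + m) * 'cV[R]_(m + m)) : 'cV[R]_(m + m) :=
  y.2 - y.1 - th *m symplmx *m discrete_grad H y.1 y.2.

End Hamiltonian.

(* Main.v *)
Require Import Defs.
From HB Require Import structures.
From mathcomp Require Import all_boot all_order all_algebra.
From mathcomp Require Import complex.
From mathcomp Require Import all_classical all_reals all_analysis.
From mathcomp Require Import ring lra.

Import Order.TTheory GRing.Theory Num.Theory.
Import numFieldNormedType.Exports.

Local Open Scope classical_set_scope.
Local Open Scope ring_scope.

(** Write A for the Jacobi matrix S H_yy at ybar, G for A coth (h A / 2), F for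
    the vector field at ybar and M for the skew-symmetric matrix
    skew_hess H ybar.

    Along a staircase edge the increment quotient of H agrees to first order
    with the mean of the affine approximations of dH/dy^j at the two ends of
    the edge.  Hence, at the diagonal point (ybar, ybar), the discrete gradient
    has the differential
      (nu0, nu1) |-> (H_yy - M) / 2 nu0 + (H_yy + M) / 2 nu1
    (lemmas discrete_grad_mean and discrete_grad_eps).  The linearised scheme,
    multiplied by 2 theta^-1 = S M + G, therefore loses its dependence on M and
    becomes
      (G - A) nu1 = (G + A) nu0 + 2 F.
    The scalar identities
      (z coth (h z / 2) - z) h phi1 (h z) = 2,
      z coth (h z / 2) + z = (z coth (h z / 2) - z) e^(h z)
    turn, by functional calculus, into
      (G - A) h phi1 (h A) = 2,    G + A = (G - A) e^(h A)
    (lemma mxfun_step), so that G - A is invertible and the linear equation says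
    exactly nu1 = e^(h A) nu0 + h phi1 (h A) F.

    The rest of the work is the functional calculus.  A matrix function is
    defined here by a real polynomial with prescribed derivatives on the complex
    spectrum, so three facts are needed.  Such a polynomial exists (Newton
    interpolation, averaged with its conjugate: interpolates_exists); the value
    at A of a real polynomial depends only on its jets on the spectrum
    (eq_horner_mx, from the theorem of Cayley and Hamilton); and the functions
    involved have complex derivatives of every order near the spectrum, so that
    jets can be multiplied.  For the last point the relation tangent, equality
    of jets between functions that are differentiable near a point, is shown to
    be compatible with sums, products and inverses.  The delicate case is phi1
    at the origin, where the k-th derivative of phi1 is exhibited in closed form
    and its differentiability at 0 follows from a mean value inequality
    (is_derive_phi_der0). *)

Set Implicit Arguments.
Unset Strict Implicit.
Unset Printing Implicit Defensive.

(** * Jets of functions of one variable *)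

Section Tangency.
Variable K : numFieldType.
Implicit Types (f g : K -> K) (z c w : K) (p : {poly K}) (n : nat).

(** Equality of the jets of order n - 1 at z, between functions that are n times
    differentiable near z.  It is a partial equivalence relation: tangent n f f z
    says that f is n times differentiable near z.  Recursion through the
    derivatives makes every closure property below an induction on n. *)
Fixpoint tangent n f g z : Prop :=
  if n is n'.+1 then
    [/\ f z = g z, \forall w \near z, derivable f w 1,
        \forall w \near z, derivable g w 1 &
        tangent n' (derive1 f) (derive1 g) z]
  else True.

Lemma near_all z (P : K -> Prop) : (forall w, P w) -> \forall w \near z, P w.
Proof. by move=> Pw; near=> w; exact: Pw. Unshelve. all: by end_near. Qed.

Lemma tangent_sym n f g z : tangent n f g z -> tangent n g f z.
Proof. by elim: n f g => //= n IH f g [-> ? ? /IH]. Qed.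

Lemma tangent_trans n f g k z :
  tangent n f g z -> tangent n g k z -> tangent n f k z.
Proof.
elim: n f g k => //= n IH f g k [-> df _ t1] [-> _ dk t2].
by split => //; exact: IH t1 t2.
Qed.

Lemma tangentW n f g z : tangent n.+1 f g z -> tangent n f g z.
Proof.
elim: n f g => [//|n IH f g [fg df dg t]]; split.
- exact: fg.
- exact: df.
- exact: dg.
exact: IH t.
Qed.

Lemma tangent_leq m n f g z : (m <= n)%N -> tangent n f g z -> tangent m f g z.
Proof.
move=> /subnKC <-; elim: (n - m)%N => [|k IH]; first by rewrite addn0.
by rewrite addnS => /tangentW/IH.
Qed.

Lemma near_eq_derive1 f g z : (\forall w \near z, f w = g w) ->
  \forall w \near z, derive1 f w = derive1 g w.
Proof.
move=> /near_join; apply: filterS => w fg.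
by rewrite !derive1E; exact: near_eq_derive.
Qed.

Lemma tangent_near n f1 f2 g z : (\forall w \near z, f1 w = f2 w) ->
  tangent n f1 g z -> tangent n f2 g z.
Proof.
elim: n f1 f2 g => [//|n IH] f1 f2 g f12 [fg df dg t]; split.
- by rewrite -fg (nbhs_singleton f12).
- move/near_join: f12 df; apply: filterS2 => w; exact: near_eq_derivable.
- exact: dg.
- exact/(IH (derive1 f1))/t/near_eq_derive1.
Qed.

Lemma tangent_near2 n f1 f2 g1 g2 z :
  (\forall w \near z, f1 w = f2 w) -> (\forall w \near z, g1 w = g2 w) ->
  tangent n f1 g1 z -> tangent n f2 g2 z.
Proof.
move=> f12 g12 /(tangent_near f12)/tangent_sym.
by move=> /(tangent_near g12)/tangent_sym.
Qed.

Lemma tangent_derive1n n f g z j : tangent n f g z -> (j < n)%N ->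
  derive1n j f z = derive1n j g z.
Proof.
elim: n f g j => //= n IH f g [|j] [fg _ _ t] jn; first exact: fg.
by rewrite !derive1Sn (IH _ _ _ t).
Qed.

Lemma derive1n_tangent n f g z : tangent n f f z -> tangent n g g z ->
  (forall j, (j < n)%N -> derive1n j f z = derive1n j g z) -> tangent n f g z.
Proof.
elim: n f g => [//|n IH] f g [_ df _ tf] [_ dg _ tg] fg; split.
- exact: (fg 0%N).
- exact: df.
- exact: dg.
by apply: IH => // j jn; rewrite -!derive1Sn fg.
Qed.

Lemma tangent_cst n c z : tangent n (cst c) (cst c) z.
Proof.
have dc d : derive1 (cst d : K -> K) = cst 0.
  by apply/funext => w; rewrite derive1_cst.
elim: n c => [//|n IH c]; split; last by rewrite dc; exact: IH.
- by [].
- by apply: near_all => w; exact: derivable_cst.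
- by apply: near_all => w; exact: derivable_cst.
Qed.

Lemma tangentD n f1 f2 g1 g2 z : tangent n f1 f2 z -> tangent n g1 g2 z ->
  tangent n (f1 + g1) (f2 + g2) z.
Proof.
elim: n f1 f2 g1 g2 => [//|n IH] f1 f2 g1 g2 [fe d1 d2 tf] [ge e1 e2 tg].
have D f g w : derivable f w 1 -> derivable g w 1 ->
    (derive1 f + derive1 g) w = derive1 (f + g) w.
  by move=> df dg; rewrite derive1E (deriveD df dg) -!derive1E.
split; first by rewrite !fctE fe ge.
- by apply: filterS2 d1 e1 => w; exact: derivableD.
- by apply: filterS2 d2 e2 => w; exact: derivableD.
- apply: tangent_near2 (IH _ _ _ _ tf tg).
  + by apply: filterS2 d1 e1 => w; exact: D.
  + by apply: filterS2 d2 e2 => w; exact: D.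
Qed.

Lemma tangentM n f1 f2 g1 g2 z : tangent n f1 f2 z -> tangent n g1 g2 z ->
  tangent n (f1 * g1) (f2 * g2) z.
Proof.
elim: n f1 f2 g1 g2 => [//|n IH] f1 f2 g1 g2 tf1 tg1.
have tf := tangentW tf1; have tg := tangentW tg1.
case: tf1 tg1 => [fe d1 d2 tf'] [ge e1 e2 tg'].
have D f g w : derivable f w 1 -> derivable g w 1 ->
    (f * derive1 g + g * derive1 f) w = derive1 (f * g) w.
  by move=> df dg; rewrite derive1E (deriveM df dg) -!derive1E.
split; first by rewrite !fctE fe ge.
- by apply: filterS2 d1 e1 => w; exact: derivableM.
- by apply: filterS2 d2 e2 => w; exact: derivableM.
- apply: tangent_near2 (tangentD (IH _ _ _ _ tf tg') (IH _ _ _ _ tg tf')).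
  + by apply: filterS2 d1 e1 => w; exact: D.
  + by apply: filterS2 d2 e2 => w; exact: D.
Qed.

Lemma derivable1_continuous f w : derivable f w 1 -> {for w, continuous f}.
Proof. by move=> /derivable1_diffP/differentiable_continuous. Qed.

Lemma near_neq0 f z : {for z, continuous f} -> f z != 0 ->
  \forall w \near z, f w != 0.
Proof. by move=> fc fz; move/cvgr_neq0: fc; apply. Qed.

Lemma tangentV n f1 f2 z : f1 z != 0 -> tangent n f1 f2 z ->
  tangent n (fun w => (f1 w)^-1) (fun w => (f2 w)^-1) z.
Proof.
move=> fz; elim: n => // n IH t; have := IH (tangentW t) => tV.
case: t => fe d1 d2 t'.
have D f w : f w != 0 -> derivable f w 1 ->
    (cst (-1) * ((fun w => (f w)^-1) * (fun w => (f w)^-1)) * derive1 f) w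
       = derive1 (fun w => (f w)^-1) w.
  move=> fw df; rewrite derive1E (deriveV fw df) !fctE -derive1E -invfM -expr2.
  by rewrite mulN1r.
have n1 : \forall w \near z, f1 w != 0.
  apply: near_neq0 => //; apply: derivable1_continuous.
  exact: nbhs_singleton d1.
have n2 : \forall w \near z, f2 w != 0.
  apply: near_neq0; rewrite -?fe//; apply: derivable1_continuous.
  exact: nbhs_singleton d2.
split; first by rewrite fe.
- by apply: filterS2 n1 d1 => w; exact: derivableV.
- by apply: filterS2 n2 d2 => w; exact: derivableV.
- have t1 := tangentM (tangentM (tangent_cst n (-1) z) (tangentM tV tV)) t'.
  apply: tangent_near2 t1.
  + by apply: filterS2 n1 d1 => w; exact: D.
  + by apply: filterS2 n2 d2 => w; exact: D.
Qed.

Lemma is_derive_scale f c w (df : K) : is_derive (c * w) 1 f df ->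
  is_derive w 1 (fun x => f (c * x)) (c * df).
Proof.
move=> [fd fE].
have dc : is_diff w ( *%R c) ( *%R c) by exact: is_diff_scaler.
have df' : differentiable f (c * w) by exact/derivable1_diffP.
have dfc : differentiable (f \o *%R c) w by exact: differentiable_comp.
split; first exact/derivable1_diffP.
rewrite [LHS](deriveE _ dfc).
rewrite (diff_comp (@ex_diff _ _ _ _ _ _ _ dc) df') /comp.
have dcE := @diff_val _ _ _ _ _ _ _ dc.
apply: etrans (congr1 (fun k : K -> K => 'd f (c * w) (k 1)) dcE) _.
by rewrite linearZ/= -(deriveE _ df') fE.
Qed.

Lemma near_scale (P : K -> Prop) c z : (\forall w \near c * z, P w) ->
  \forall w \near z, P (c * w).
Proof. by move=> Pc; exact: (@mulrl_continuous K c z). Qed.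

Lemma tangent_scale n f g c z : tangent n f g (c * z) ->
  tangent n (fun w => f (c * w)) (fun w => g (c * w)) z.
Proof.
have D k w : derivable k (c * w) 1 ->
    (cst c * (fun x => derive1 k (c * x))) w = derive1 (fun x => k (c * x)) w.
  move=> /derivableP/is_derive_scale/(@derive_val _ _ _ _ _ _ _).
  by rewrite !derive1E => ->; rewrite !fctE derive1E.
elim: n f g => [//|n IH f g [fg /near_scale df /near_scale dg t]]; split.
- exact: fg.
- by apply: filterS df => w /derivableP/is_derive_scale [].
- by apply: filterS dg => w /derivableP/is_derive_scale [].
- apply: tangent_near2 (tangentM (tangent_cst n c z) (IH _ _ t)).
  + by apply: filterS df => w; exact: D.
  + by apply: filterS dg => w; exact: D.
Qed.

Lemma is_derive_horner p w : is_derive w 1 (horner p) p^`().[w].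
Proof.
elim/poly_ind: p => [|p c IH].
  rewrite deriv0 horner0 (_ : horner 0 = cst 0); first exact: is_derive_cst.
  by apply/funext => x; rewrite horner0.
rewrite (_ : horner _ = horner p * id + cst c); last first.
  by apply/funext => x; rewrite !hornerE.
apply: is_derive_eq.
rewrite derivD derivC addr0 derivM derivX !hornerE /GRing.scale/= mulr1.
by rewrite addrC mulrC.
Qed.

Lemma derive1_horner p : derive1 (horner p) = horner p^`().
Proof.
apply/funext => w; rewrite derive1E.
by rewrite (@derive_val _ _ _ _ _ _ _ (is_derive_horner p w)).
Qed.

Lemma derive1n_horner p n : derive1n n (horner p) = horner p^`(n)%R.
Proof.
by elim: n p => // n IH p; rewrite derive1Sn derive1_horner IH -derivSn.
Qed.

Lemma tangent_horner n p z : tangent n (horner p) (horner p) z.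
Proof.
elim: n p => [//|n IH p]; split; last by rewrite derive1_horner; exact: IH.
- by [].
- by apply: near_all => w; have [] := is_derive_horner p w.
- by apply: near_all => w; have [] := is_derive_horner p w.
Qed.

Lemma tangent_id n z : tangent n (fun w => w) (fun w => w) z.
Proof.
have := tangent_horner n 'X z.
by rewrite (_ : horner 'X = fun w => w)//; apply/funext => w; rewrite hornerX.
Qed.

Lemma tangent_derive_seq (F : nat -> K -> K) n z :
  (forall k w, is_derive w 1 (F k) (F k.+1 w)) -> tangent n (F 0%N) (F 0%N) z.
Proof.
move=> FD.
have dF k : derive1 (F k) = F k.+1.
  by apply/funext => w; rewrite derive1E (@derive_val _ _ _ _ _ _ _ (FD k w)).
have aF k : \forall w \near z, derivable (F k) w 1.
  by apply: near_all => w; case: (FD k w).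
suff : forall k, tangent n (F k) (F k) z by apply.
elim: n => [//|n IH] k; split; [by []|exact: aF|exact: aF|].
by rewrite dF; exact: IH.
Qed.

Lemma is_derive_eps f z (d : K) :
  (forall e : K, 0 < e ->
     \forall h \near (0 : K), `|f (h + z) - f z - h * d| <= e * `|h|) ->
  is_derive z 1 f d.
Proof.
move=> fd.
suff L : (fun h => h^-1 *: ((f \o shift z) (h *: 1) - f z)) @ (0 : K)^' --> d.
  by split; [apply/cvg_ex; exists d|exact: cvg_lim].
apply/cvgrPdist_le => e e0.
rewrite near_withinE; apply: filterS (fd e e0) => h fh h0 /=.
rewrite [h%:A]mulr1 distrC /GRing.scale/=.
rewrite -(ler_pM2r (_ : 0 < `|h|)) ?normr_gt0// -normrM.
by rewrite mulrC mulrBr mulVKf.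
Qed.

Lemma eps_is_derive f z (d e : K) : is_derive z 1 f d -> 0 < e ->
  \forall h \near (0 : K), `|f (h + z) - f z - h * d| <= e * `|h|.
Proof.
move=> [fd <-] e0.
have /cvgrPdist_le/(_ e e0) := fd; rewrite near_withinE.
apply: filterS => h /= fh.
have [->|h0] := eqVneq h 0.
  by rewrite add0r subrr mul0r subr0 !normr0 mulr0.
move/(_ h0): fh; rewrite [h%:A]mulr1 distrC /GRing.scale/=.
rewrite -(ler_pM2r (_ : 0 < `|h|)) ?normr_gt0// -normrM.
by rewrite [X in `|X|]mulrC mulrBr mulVKf.
Qed.

Lemma near0P (P : K -> Prop) : (\forall x \near (0 : K), P x) <->
  exists2 d : K, 0 < d & forall x, `|x| < d -> P x.
Proof. exact: nbhs_norm0P. Qed.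

Lemma is_derive_cM f z c (d : K) : is_derive z 1 f d ->
  is_derive z 1 (fun x => c * f x) (c * d).
Proof.
move=> fd; have := is_deriveM (is_derive_cst c z 1) fd.
by rewrite scaler0 addr0.
Qed.

Lemma is_derive_exprn k z :
  is_derive z 1 (fun w : K => w ^+ k) (k%:R * z ^+ k.-1).
Proof.
have := is_derive_horner 'X^k z.
rewrite derivXn hornerMn hornerXn mulr_natl (_ : horner _ = (fun w => w ^+ k))//.
by apply/funext => w; rewrite hornerXn.
Qed.

End Tangency.

(** * The complex exponential *)

Section ComplexExp.
Local Arguments Defs.cexp : simpl never.
Variable R : realType.
Local Notation C := (R[i] : numFieldType).
Local Notation "x %:C" := (real_complex R x) (format "x %:C") : ring_scope.
Local Notation Re := (@complex.Re R).
Local Notation Im := (@complex.Im R).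
Local Notation cexp := (@cexp R).
Local Notation conj := (@conjc R).
Implicit Types (z w c : R[i]).

Lemma normc_Re z : `|Re z|%:C <= `|z|.
Proof. by rewrite normc_def lecR -sqrtr_sqr ler_wsqrtr// lerDl sqr_ge0. Qed.

Lemma normc_Im z : `|Im z|%:C <= `|z|.
Proof. by rewrite normc_def lecR -sqrtr_sqr ler_wsqrtr// lerDr sqr_ge0. Qed.

Lemma normc_ReIm z : `|z| <= (`|Re z| + `|Im z|)%:C.
Proof.
rewrite normc_def lecR -[leRHS]ger0_norm ?addr_ge0// -sqrtr_sqr ler_wsqrtr//.
rewrite sqrrD !real_normK ?num_real// addrAC lerDl.
by rewrite mulrn_wge0// mulr_ge0.
Qed.

Lemma normc_real (x : R) : `|x%:C| = `|x|%:C.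
Proof. by rewrite normc_def/= expr0n addr0 sqrtr_sqr. Qed.

Lemma normc_conj z : `|conj z| = `|z|.
Proof. by case: z => a b; rewrite !normc_def/= sqrrN. Qed.

Lemma gt0_realc (e : R[i]) : 0 < e -> exists2 x : R, 0 < x & e = x%:C.
Proof. by case: e => a b; rewrite ltcE/= => /andP[/eqP-> a0]; exists a. Qed.

Lemma realc_neq0 (x : R) : x != 0 -> x%:C != 0.
Proof. by move=> x0; rewrite eq_complex/= eqxx andbT. Qed.

Lemma near0_Re (P : R -> Prop) : (\forall x \near (0 : R), P x) ->
  \forall z \near (0 : C), P (Re z).
Proof.
move=> /near0P[d /= d0 Pd]; apply/near0P; exists d%:C => /=; first by rewrite ltcR.
by move=> z zd; apply: Pd; rewrite /= -ltcR; exact: le_lt_trans (normc_Re z) zd.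
Qed.

Lemma near0_Im (P : R -> Prop) : (\forall x \near (0 : R), P x) ->
  \forall z \near (0 : C), P (Im z).
Proof.
move=> /near0P[d /= d0 Pd]; apply/near0P; exists d%:C => /=; first by rewrite ltcR.
by move=> z zd; apply: Pd; rewrite /= -ltcR; exact: le_lt_trans (normc_Im z) zd.
Qed.

Lemma near0_realc (P : R[i] -> Prop) : (\forall z \near (0 : C), P z) ->
  \forall x \near (0 : R), P x%:C.
Proof.
move=> /near0P[d /= /gt0_realc[e e0 ->] Pd].
apply/near0P; exists e => //= x xe.
by apply: Pd; rewrite /= normc_real ltcR.
Qed.

Lemma cexpD z w : cexp (z + w) = cexp z * cexp w.
Proof.
case: z w => [a b] [c d]; apply/eqP; rewrite eq_complex /=.
by rewrite expRD cosD sinD; apply/andP; split; apply/eqP; ring.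
Qed.

Lemma cexp0 : cexp 0 = 1.
Proof.
by apply/eqP; rewrite eq_complex/= expR0 cos0 sin0 mulr0 mulr1 !eqxx.
Qed.

Lemma cexp_neq0 z : cexp z != 0.
Proof.
apply/eqP => E; have := cexpD z (- z); rewrite subrr cexp0 E mul0r => /eqP.
by rewrite oner_eq0.
Qed.

Lemma cexpN z : cexp (- z) = (cexp z)^-1.
Proof.
apply: (mulfI (cexp_neq0 z)).
by rewrite mulfV ?cexp_neq0// -cexpD subrr cexp0.
Qed.

(** By the functional equation, complex differentiability of the exponential is
    needed only at 0.  There, with h = a + i b, it follows from the real
    derivatives at 0 through
      e^a cos b - 1 - a = (e^a - 1 - a) cos b + (1 + a) (cos b - 1),
      e^a sin b - b = (e^a - 1 - a) sin b + (1 + a) (sin b - b) + a b. *)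
Lemma cexp_near0 (e : R[i]) : 0 < e ->
  \forall h \near (0 : C), `|cexp h - 1 - h| <= e * `|h|.
Proof.
move=> /gt0_realc[x x0 ->].
(* the two parts add up to at most d (3 |a| + 5 |b|) <= 8 d |h| *)
pose d : R := Num.min 1 (x / 8).
have d0 : 0 < d by rewrite lt_min ltr01 divr_gt0.
have d1 : d <= 1 by rewrite ge_min lexx.
have dx : d <= x / 8 by rewrite ge_min lexx orbT.
have E := near0_Re (eps_is_derive (is_derive_expR (0 : R)) d0).
have Co := near0_Im (eps_is_derive (is_derive_cos (0 : R)) d0).
have S := near0_Im (eps_is_derive (is_derive_sin (0 : R)) d0).
have B : \forall h \near (0 : C), `|Re h| <= d.
  apply: (@near0_Re (fun a => `|a| <= d)).
  by apply/near0P; exists d => // y /ltW.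
apply: filterS (filterI (filterI (filterI E Co) S) B) => h [[[]]].
have := normc_Re h; have := normc_Im h.
case: h => a b; rewrite /cexp/= !addr0 expR0 cos0 sin0 oppr0 mulr0 !subr0 !mulr1.
rewrite ?addr0; set N := `|_ +i* _|%C => bN aN Ed Cd Sd ad.
apply: le_trans (normc_ReIm _) _ => /=; rewrite oppr0 addr0 /=.
apply: (@le_trans _ _ ((3 * d * `|a| + 5 * d * `|b|)%:C)); last first.
  apply: (@le_trans _ _ ((8 * d)%:C * N)); last first.
    by rewrite ler_wpM2r ?normr_ge0// lecR; lra.
  have -> : (8 * d)%:C = (3 * d)%:C + (5 * d)%:C.
    by rewrite -rmorphD; congr _%:C; ring.
  have -> : (3 * d * `|a| + 5 * d * `|b|)%:C =
      (3 * d)%:C * `|a|%:C + (5 * d)%:C * `|b|%:C by rewrite -!rmorphM -rmorphD.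
  rewrite (mulrDl (3 * d)%:C).
  by apply: lerD; rewrite ler_wpM2l// lecR; lra.
rewrite lecR.
have -> : expR a * cos b - 1 - a =
    (expR a - 1 - a) * cos b + (1 + a) * (cos b - 1) by ring.
have -> : expR a * sin b - b =
    (expR a - 1 - a) * sin b + (1 + a) * (sin b - b) + a * b by ring.
have a1 : `|1 + a| <= 2 by apply: le_trans (ler_normD _ _) _; rewrite normr1; lra.
have T1 : `|(expR a - 1 - a) * cos b| <= d * `|a|.
  by rewrite normrM -[leRHS]mulr1 ler_pM// cos_max.
have T2 : `|(expR a - 1 - a) * sin b| <= d * `|a|.
  by rewrite normrM -[leRHS]mulr1 ler_pM// sin_max.
have T3 : `|(1 + a) * (cos b - 1)| <= 2 * (d * `|b|) by rewrite normrM ler_pM.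
have T4 : `|(1 + a) * (sin b - b)| <= 2 * (d * `|b|) by rewrite normrM ler_pM.
have T5 : `|a * b| <= d * `|b| by rewrite normrM ler_wpM2r.
have := ler_normD ((expR a - 1 - a) * cos b) ((1 + a) * (cos b - 1)).
have := ler_normD ((expR a - 1 - a) * sin b + (1 + a) * (sin b - b)) (a * b).
have := ler_normD ((expR a - 1 - a) * sin b) ((1 + a) * (sin b - b)).
have : 0 <= d * `|a| by rewrite mulr_ge0// ltW.
have : 0 <= d * `|b| by rewrite mulr_ge0// ltW.
rewrite -!mulrA.
lra.
Qed.

Lemma is_derive_cexp z : is_derive (z : C) 1 (cexp : C -> C) (cexp z).
Proof.
apply: is_derive_eps => e e0.
have n0 : 0 < `|cexp z : C| by rewrite normr_gt0 cexp_neq0.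
have ez : 0 < e / `|cexp z : C| by exact: divr_gt0.
apply: filterS (cexp_near0 ez) => h he.
rewrite cexpD.
have -> : cexp h * cexp z - cexp z - h * cexp z = (cexp h - 1 - h) * cexp z.
  by ring.
rewrite normrM -ler_pdivlMr//; apply: le_trans he _.
by rewrite mulrAC.
Qed.

Lemma tangent_cexp n (z : C) : tangent n (cexp : C -> C) cexp z.
Proof.
by apply: (@tangent_derive_seq C (fun=> cexp)) => k w; exact: is_derive_cexp.
Qed.

(** * Mean value inequality *)

Lemma is_derive_Re (F : C -> C) (t : R) (D : R[i]) :
  is_derive (t%:C : C) 1 F D -> is_derive t 1 (fun s => Re (F s%:C)) (Re D).
Proof.
move=> FD; apply: is_derive_eps => e e0.
have e0C : 0 < e%:C :> C by rewrite ltcR.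
apply: filterS (near0_realc (eps_is_derive FD e0C)) => h.
rewrite normc_real -rmorphM -(rmorphD _ h t)/= => he.
rewrite -lecR; apply: le_trans he; apply: le_trans (normc_Re _).
rewrite lecR; case: (F _) (F t%:C) D {FD} => [a b] [a' b'] [c d] /=.
by rewrite mul0r subr0.
Qed.

(** The real mean value theorem along the segment from 0 to z, applied to
    Re (conj (u z) * u (t z)): at t = 1 this function has the value |u z|^2. *)
Lemma mean_value_cineq (u u' : C -> C) (z : C) (M : R) :
  u 0 = 0 -> (forall w : C, `|w| <= `|z| -> is_derive w 1 u (u' w)) ->
  (forall w, `|w| <= `|z| -> `|u' w| <= M%:C) -> `|u z| <= M%:C * `|z|.
Proof.
move=> u0 du bu.
pose c := conj (u z).
have dF (t : R) : 0 <= t <= 1 ->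
    is_derive t 1 (fun s => Re (c * u (z * s%:C))) (Re (c * (z * u' (z * t%:C)))).
  move=> /andP[t0 t1]; apply: (@is_derive_Re (fun x : C => c * u (z * x))).
  have tz : `|z * t%:C| <= `|z|.
    by rewrite normrM normc_real (ger0_norm t0) ler_piMr// lecR.
  exact: is_derive_cM (is_derive_scale (du _ tz)).
have [|||t t01] := @MVT_segment R (fun s => Re (c * u (z * s%:C)))
  (fun t => Re (c * (z * u' (z * t%:C)))) 0 1.
- exact: ler01.
- by move=> x; rewrite in_itv/= => /andP[x0 x1]; apply: dF; rewrite !ltW.
- apply: derivable_within_continuous => x; rewrite in_itv/= => x01.
  by case: (dF x x01).
rewrite mulr1 mulr0 u0 mulr0 subr0 subr0 mulr1.
have -> : c * u z = `|u z| ^+ 2 by rewrite sqr_normc mulrC.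
move=> E.
have := normr_ge0 (u z); rewrite le_eqVlt => /predU1P[<-|uz0].
  by rewrite mulr_ge0// -(normr0 C); apply: le_trans (bu 0 _); rewrite ?normr0.
rewrite -(ler_pM2l uz0) -expr2.
have -> : `|u z| ^+ 2 = (Re (`|u z| ^+ 2))%:C.
  by rewrite RRe_real// realX// normr_real.
rewrite E; apply: (@le_trans _ _ `|Re (c * (z * u' (z * t%:C)))|%:C).
  by rewrite lecR ler_norm.
apply: le_trans (normc_Re _) _; rewrite !normrM.
rewrite [`|c|]normc_conj [`|z| * _]mulrC ler_wpM2l// ler_wpM2r//; apply: bu.
move: t01; rewrite in_itv/= => /andP[t0 t1].
by rewrite normrM normc_real (ger0_norm t0) ler_piMr// lecR.
Qed.

(** * Derivatives of phi1 *)

Local Notation phi1 := (@phi1 R).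

(** The integral of s^k e^s along the segment from 0 to z, so that
    phi_num k z / z^(k + 1) is the integral of t^k e^(t z) over [0, 1], which is
    the k-th derivative of phi1 at z. *)
Fixpoint phi_num k (z : C) : C :=
  if k is k'.+1 then z ^+ k * cexp z - k%:R * phi_num k' z else cexp z - 1.

Definition phi_der k (z : C) : C :=
  if z == 0 then k.+1%:R^-1 else phi_num k z / z ^+ k.+1.

Lemma phi_num0 k : phi_num k 0 = 0.
Proof.
elim: k => [|k IH] /=; first by rewrite cexp0 subrr.
by rewrite IH expr0n/= mul0r mulr0 subrr.
Qed.

Lemma is_derive_phi_num k (z : C) : is_derive z 1 (phi_num k) (z ^+ k * cexp z).
Proof.
elim: k => [|k IH].
  have := is_deriveB (is_derive_cexp z) (is_derive_cst (1 : C) (z : C) 1).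
  by rewrite subr0 expr0 mul1r.
have e1 := is_deriveM (is_derive_exprn k.+1 (z : C)) (is_derive_cexp z).
have e2 := is_derive_cM k.+1%:R IH.
apply: (is_derive_eq (is_deriveB e1 e2)).
rewrite /GRing.scale/=; ring.
Qed.

Lemma phi_derE : phi_der 0 = phi1.
Proof.
apply/funext => z; rewrite /phi_der /Defs.phi1.
by case: eqP => // _; rewrite invr1.
Qed.

Lemma is_derive_phi_der_neq0 k (z : C) : z != 0 ->
  is_derive z 1 (phi_der k) (phi_der k.+1 z).
Proof.
move=> z0.
have zn : z ^+ k.+1 != 0 by rewrite expf_neq0.
have near0 : \forall w \near z, w != 0.
  by apply: (@near_neq0 C id z _ z0); exact: cvg_id.
have dV : is_derive z 1 (fun w : C => (w ^+ k.+1)^-1)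
    (- (z ^+ k.+1) ^- 2 * (k.+1%:R * z ^+ k)).
  have d := is_derive_exprn k.+1 z; case: (d) => d1 d2.
  pose p (w : C) := w ^+ k.+1.
  split; first exact: (@derivableV _ _ p z 1 zn d1).
  by apply: etrans (@deriveV _ _ p z 1 zn d1) _; rewrite d2.
have := is_deriveM (is_derive_phi_num k z) dV.
have e w : w != 0 ->
    (phi_num k * (fun w : C => (w ^+ k.+1)^-1)) w = phi_der k w.
  by move=> w0; rewrite /phi_der (negPf w0).
move/(near_eq_is_derive (filterS e near0)) => d; apply: (is_derive_eq d).
rewrite /phi_der (negPf z0) /GRing.scale/= !exprS ?expr0 ?mulr1.
move: (phi_num k z) (z ^+ k) (expf_neq0 k z0) => p q q0.
by field; rewrite z0 q0.
Qed.

(** The error of the affine approximation of phi_der k at 0 is u h / h^(k + 1),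
    where u vanishes at 0 and u' w = w^k (e^w - 1 - w).  Differentiability of
    the exponential at 0 makes u' w = o(w^(k + 1)), and the mean value
    inequality turns this into u h = o(h^(k + 2)). *)
Lemma is_derive_phi_der0 k : is_derive (0 : C) 1 (phi_der k) (phi_der k.+1 0).
Proof.
apply: is_derive_eps => e e0.
have [r /= r0 re] := (near0P _).1 (cexp_near0 e0).
apply/near0P; exists r => //= h hr.
rewrite addr0 /phi_der eqxx.
have [->|h0] := eqVneq h 0; first by rewrite subrr mul0r subrr !normr0 mulr0.
pose u (w : C) :=
  phi_num k w - (k.+1%:R^-1 * w ^+ k.+1 + k.+2%:R^-1 * w ^+ k.+2).
have -> : phi_num k h / h ^+ k.+1 - k.+1%:R^-1 - h * k.+2%:R^-1 = u h / h ^+ k.+1.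
  rewrite /u !exprS; move: (phi_num k h) (h ^+ k) (expf_neq0 k h0) => p q q0.
  by field; rewrite q0 h0 -(natrD _ 2 k) nat1r !pnatr_eq0.
have hn : 0 < `|h ^+ k.+1| by rewrite normr_gt0 expf_neq0.
rewrite normrM normfV ler_pdivrMr//.
have [M M0 ME] : exists2 M : R, 0 < M & e * `|h| ^+ k.+1 = M%:C.
  by apply: gt0_realc; rewrite mulr_gt0// exprn_gt0// normr_gt0.
have := @mean_value_cineq u (fun w => w ^+ k * (cexp w - 1 - w)) h M.
rewrite -ME normrX [leRHS]mulrAC; apply.
- by rewrite /u phi_num0 !expr0n/= !mulr0 addr0 subr0.
- move=> w _.
  have d1 := is_derive_cM k.+1%:R^-1 (is_derive_exprn k.+1 (w : C)).
  have d2 := is_derive_cM k.+2%:R^-1 (is_derive_exprn k.+2 (w : C)).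
  apply: (is_derive_eq (is_deriveB (is_derive_phi_num k w) (is_deriveD d1 d2))).
  rewrite /= !mulKf ?pnatr_eq0// exprS; ring.
- move=> w wh; rewrite normrM normrX.
  apply: le_trans (ler_wpM2l _ (re w _)) _; rewrite ?exprn_ge0//=.
    exact: le_lt_trans hr.
  rewrite mulrCA -exprSr ler_wpM2l ?(ltW e0)//.
  by rewrite lerXn2r ?nnegrE.
Qed.

Lemma tangent_phi1 n (z : C) : tangent n (phi1 : C -> C) phi1 z.
Proof.
rewrite -phi_derE; apply: tangent_derive_seq => k w.
have [->|] := eqVneq w 0.
  exact: is_derive_phi_der0.
exact: is_derive_phi_der_neq0.
Qed.

Lemma tangent_phi1_scale n (h : R) (z : C) :
  tangent n (fun w : C => phi1 (h%:C * w)) (fun w => phi1 (h%:C * w)) z.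
Proof. exact: (@tangent_scale C n phi1 phi1 h%:C z (tangent_phi1 _ _)). Qed.

(** * Reduction of z coth (h z / 2) to phi1 *)

Lemma mul_phi1 z : z * phi1 z = cexp z - 1.
Proof.
rewrite /phi1; have [->|z0] := eqVneq z 0; first by rewrite cexp0 subrr mul0r.
by rewrite mulrC divfK.
Qed.

Lemma csinhE z : csinh z = (cexp (z *+ 2) - 1) / (2 * cexp z).
Proof.
rewrite /csinh cexpN mulr2n cexpD.
by have e0 := cexp_neq0 z; field.
Qed.

Lemma phi1_neq0 z : (z != 0 -> csinh (z / 2) != 0) -> phi1 z != 0.
Proof.
rewrite csinhE (_ : z / 2 *+ 2 = z); last first.
  by rewrite -mulr_natr divfK ?pnatr_eq0.
rewrite -mul_phi1 => zs.
have [->|z0] := eqVneq z 0; first by rewrite /phi1 eqxx oner_neq0.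
by apply/eqP => E; move: (zs z0); rewrite E mulr0 mul0r eqxx.
Qed.

Lemma near_phi1_neq0 (h : R) (z : C) : phi1 (h%:C * z) != 0 ->
  \forall w \near z, phi1 (h%:C * w) != 0.
Proof.
apply: (@near_neq0 C (fun w => phi1 (h%:C * w))).
have [_ /nbhs_singleton d _ _] := tangent_phi1_scale 1 h z.
exact: derivable1_continuous.
Qed.

(** For z <> 0 this is coth (x / 2) = 1 + 2 / (e^x - 1) with e^x - 1 = x phi1 x;
    the values given to zcoth and phi1 at 0 satisfy it too.  So zcoth inherits
    its regularity at 0 from phi1. *)
Lemma zcothE (h : R) z : h != 0 -> phi1 (h%:C * z) != 0 ->
  zcoth h z = z + 2 / (h%:C * phi1 (h%:C * z)).
Proof.
move=> h0 p0; have hC := realc_neq0 h0.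
rewrite /zcoth; have [->|z0] := eqVneq z 0.
  by rewrite mulr0 add0r /phi1 eqxx mulr1.
have hz : h%:C * z != 0 by rewrite mulf_neq0.
have -> : h%:C * phi1 (h%:C * z) = (cexp (h%:C * z) - 1) / z.
  by rewrite -mul_phi1 [h%:C * z * _]mulrAC mulfK.
have {p0} : cexp (h%:C * z) - 1 != 0 by rewrite -mul_phi1 mulf_neq0.
rewrite /ccoth /csinh /ccosh cexpN.
rewrite -[in cexp (h%:C * z)](divfK (_ : 2 != 0) (h%:C * z)) ?pnatr_eq0//.
rewrite mulr_natr mulr2n cexpD.
move: (cexp _) (cexp_neq0 (h%:C * z / 2)) => E E0 E1.
have E2 : E - E^-1 != 0.
  apply: contraNneq E1 => E1; have : E * (E - E^-1) = 0 by rewrite E1 mulr0.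
  by rewrite mulrBr mulfV// => ->.
by field; rewrite E0 z0 E1.
Qed.

Lemma tangent_zcoth n (h : R) (z : C) : h != 0 -> phi1 (h%:C * z) != 0 ->
  tangent n (zcoth h : C -> C) (zcoth h) z.
Proof.
move=> h0 p0; have hC := realc_neq0 h0.
have tD : tangent n (cst h%:C * (fun w : C => phi1 (h%:C * w)))
    (cst h%:C * (fun w : C => phi1 (h%:C * w))) z.
  by apply: tangentM; [exact: tangent_cst|exact: tangent_phi1_scale].
have tV := @tangentV C n _ _ z (mulf_neq0 hC p0) tD.
have t := tangentD (tangent_id n z) (tangentM (tangent_cst n (2 : C) z) tV).
have zE : \forall w \near z, w + 2 / (h%:C * phi1 (h%:C * w)) = zcoth h w.
  by apply: filterS (near_phi1_neq0 p0) => w /(zcothE h0).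
exact: (tangent_near2 zE zE t).
Qed.

(** * Conjugation *)

Lemma cexp_conj z : cexp (conj z) = conj (cexp z).
Proof. by case: z => a b; rewrite /cexp/= cosN sinN mulrN. Qed.

Lemma phi1_conj z : phi1 (conj z) = conj (phi1 z).
Proof.
rewrite /phi1 conjc_eq0 cexp_conj; case: ifP => _; first by rewrite rmorph1.
by rewrite rmorphM rmorphB rmorph1 fmorphV.
Qed.

Lemma zcoth_conj (h : R) z : zcoth h (conj z) = conj (zcoth h z).
Proof.
rewrite /zcoth conjc_eq0; case: ifP => _.
  by rewrite rmorphM rmorph_nat fmorphV; congr (_ / _); exact/esym/conjc_real.
rewrite /ccoth /csinh /ccosh.
have E : h%:C * conj z / 2 = conj (h%:C * z / 2).
  rewrite !rmorphM fmorphV rmorph_nat; congr (_ * _ / _).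
  exact/esym/conjc_real.
rewrite E -rmorphN !cexp_conj; move: (cexp _) (cexp _) => a b.
rewrite -rmorphB -rmorphD [RHS]rmorphM; congr (_ * _).
by rewrite [RHS]fmorph_div [X in _ = X / _]fmorph_div [X in _ = _ / X]fmorph_div
  rmorph_nat.
Qed.

Lemma is_derive_conj (f : C -> C) (z d : C) :
  (\forall w \near z, f (conj w) = conj (f w)) ->
  is_derive z 1 f d -> is_derive (conj z : C) 1 f (conj d : C).
Proof.
move=> fc fd; apply: is_derive_eps => e e0.
have fc0 := nbhs_singleton fc.
have fc1 : \forall w \near (0 : C), f (conj (w + z)) = conj (f (w + z)).
  move: fc; rewrite (near_shift 0 z); apply: filterS => w; rewrite /= subr0.
  by [].
have [r /= r0 rP] := (near0P _).1 (filterI fc1 (eps_is_derive fd e0)).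
apply/near0P; exists r => //= k kr.
have [] := rP (conj k); first by rewrite /= normc_conj.
rewrite rmorphD/= conjcK => ->; rewrite fc0 => le.
rewrite -[k in k * _]conjcK.
have -> : conj (f (conj k + z)) - conj (f z) - conj (conj k) * conj d =
    conj (f (conj k + z) - f z - conj k * d) by rewrite !rmorphB rmorphM.
by rewrite normc_conj; rewrite normc_conj in le.
Qed.

Lemma derive1n_conj n (f : C -> C) (z : C) j :
  (\forall w \near z, f (conj w) = conj (f w)) ->
  tangent n f f z -> (j < n)%N ->
  derive1n j f (conj z : C) = conj (derive1n j f z).
Proof.
elim: n f j => // n IH f [|j] fc [_ df _ t] jn; first exact: nbhs_singleton fc.
rewrite !derive1Sn; apply: IH => //.
move/near_join: fc df; apply: filterS2 => w fc df.
have := is_derive_conj fc (derivableP df).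
by move=> /(@derive_val _ _ _ _ _ _ _); rewrite !derive1E.
Qed.

End ComplexExp.

(** * Hermite interpolation *)

Section Hermite.
Variable F : numFieldType.
Implicit Types (p q : {poly F}) (x : F) (n j : nat) (s : seq F).

Lemma deriv_XsubC_exp_mul n x p :
  (('X - x%:P) ^+ n.+1 * p)^`() =
  ('X - x%:P) ^+ n * (n.+1%:R *: p + ('X - x%:P) * p^`()).
Proof.
rewrite derivM deriv_exp derivXsubC mul1r/= exprSr.
by rewrite [RHS]mulrDr [X in _ = _ + X]mulrA scaler_nat mulrnAl mulrnAr.
Qed.

Lemma derivn_XsubC_exp_mul n x p j : (j < n)%N ->
  (('X - x%:P) ^+ n * p)^`(j).[x] = 0.
Proof.
elim: n j p => // n IH [|j] p jn.
  by rewrite derivn0 exprS -mulrA hornerM hornerXsubC subrr mul0r.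
by rewrite derivSn deriv_XsubC_exp_mul IH.
Qed.

Lemma derivn_XsubC_exp_mul_top n x p :
  (('X - x%:P) ^+ n * p)^`(n).[x] = n`!%:R * p.[x].
Proof.
elim: n p => [|n IH] p; first by rewrite mul1r mul1r.
rewrite derivSn deriv_XsubC_exp_mul IH hornerD hornerZ hornerM hornerXsubC.
by rewrite subrr mul0r addr0 mulrA -natrM mulnC -factS.
Qed.

Lemma dvdp_XsubC_exp n x p :
  reflect (forall j, (j < n)%N -> p^`(j).[x] = 0) (('X - x%:P) ^+ n %| p).
Proof.
apply: (iffP idP) => [/dvdpP[q ->] j jn|].
  by rewrite mulrC derivn_XsubC_exp_mul.
elim: n => [|n IH] pj; first by rewrite dvd1p.
have /dvdpP[q pE] := IH (fun j jn => pj j (ltnW jn)).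
have /eqP := pj n (leqnn _).
rewrite pE mulrC derivn_XsubC_exp_mul_top mulf_eq0 pnatr_eq0.
rewrite eqn0Ngt fact_gt0/= => /eqP qx.
rewrite exprSr dvdp_mul2l ?expf_neq0 ?polyXsubC_eq0// dvdp_XsubCl.
exact/rootP.
Qed.

Lemma derivn_mup_neq0 p x : p != 0 -> p^`(mup x p).[x] != 0.
Proof.
move=> p0; have := leqnn (mup x p); rewrite mup_leq//.
apply: contraNneq => px; apply/dvdp_XsubC_exp => j; rewrite ltnS leq_eqVlt.
case/predU1P => [->//|jn].
have : ('X - x%:P) ^+ mup x p %| p by rewrite -mup_geq.
by move/dvdp_XsubC_exp; apply.
Qed.

(** Newton's scheme: when a node a is added to the list s, a multiple of the
    nodal polynomial of s corrects the one new derivative at a and leaves the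
    conditions already met untouched. *)
Lemma hermite_interpolation s (v : F -> nat -> F) :
  exists p, forall x j, (j < count_mem x s)%N -> p^`(j).[x] = v x j.
Proof.
elim: s => [|a s [p pv]]; first by exists 0.
pose q := \prod_(y <- s) ('X - y%:P).
have q0 : q != 0 by rewrite monic_neq0// monic_prod_XsubC.
have qa : q^`(count_mem a s).[a] != 0.
  by rewrite -(mu_prod_XsubC a s) derivn_mup_neq0.
exists (p + ((v a (count_mem a s) - p^`(count_mem a s).[a])
              / q^`(count_mem a s).[a]) *: q) => x j /=.
rewrite derivnD derivnZ hornerD hornerZ => jn.
have qx k : (k < count_mem x s)%N -> q^`(k).[x] = 0.
  move=> kx; have : ('X - x%:P) ^+ count_mem x s %| q.
    by rewrite -mup_geq// mu_prod_XsubC.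
  by move/dvdp_XsubC_exp; apply.
have [js|sj] := ltnP j (count_mem x s).
  by rewrite qx// mulr0 addr0 pv.
have [ax|ax] := eqVneq a x; last first.
  by move: jn; rewrite (negPf ax) ltnNge sj.
move: jn; rewrite ax eqxx ltnS => jn.
have -> : j = count_mem x s by apply/eqP; rewrite eqn_leq jn sj.
by rewrite -ax divfK// addrC subrK.
Qed.

Lemma dvdp_prod_XsubC_count s p :
  (forall x, ('X - x%:P) ^+ count_mem x s %| p) ->
  \prod_(y <- s) ('X - y%:P) %| p.
Proof.
elim: s p => [|a s IH] p pd; first by rewrite big_nil dvd1p.
have [->|p0] := eqVneq p 0; first exact: dvdp0.
have /dvdpP[q pE] : 'X - a%:P %| p.
  by apply: dvdp_trans (pd a); rewrite /= eqxx exprS dvdp_mulr.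
have q0 : q != 0 by move: p0; rewrite pE mulf_eq0 negb_or => /andP[].
rewrite big_cons pE mulrC dvdp_mul2r ?polyXsubC_eq0//; apply: IH => x.
have := pd x; rewrite -!mup_geq//= pE mupM ?polyXsubC_eq0//.
by rewrite -[X in (_ + mup x X)%N]expr1 mup_XsubCX addnC; case: eqP => _;
  rewrite leq_add2r.
Qed.

End Hermite.

(** * Functions of a real matrix *)

Section MatrixFunction.
Variable R : realType.
Local Notation C := (R[i] : numFieldType).
Local Notation "x %:C" := (real_complex R x) (format "x %:C") : ring_scope.
Local Notation toC := (map_poly (real_complex R)).
Local Notation conj := (@conjc R).
Local Notation phi1 := (@phi1 R).
Local Notation cexp := (@cexp R).

Definition eigen_mult n (A : 'M[R]_n) (x : C) :=
  mup (x : R[i]) (char_poly (cplxmx A)).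

Lemma char_poly_cplxmx n (A : 'M[R]_n) :
  char_poly (cplxmx A) = toC (char_poly A).
Proof. by rewrite map_char_poly. Qed.

Lemma char_poly_roots n (A : 'M[R]_n) :
  {s : seq R[i] | char_poly (cplxmx A) = \prod_(y <- s) ('X - y%:P)}.
Proof.
have [s sE] := closed_field_poly_normal (char_poly (cplxmx A)).
by exists s; rewrite [LHS]sE (monicP (char_poly_monic _)) scale1r.
Qed.

Lemma eigen_mult_conj n (A : 'M[R]_n) x : eigen_mult A (conj x) = eigen_mult A x.
Proof.
have [s sE] := char_poly_roots A.
have sE' : char_poly (cplxmx A) = \prod_(y <- map conj s) ('X - y%:P).
  have cE : map_poly conj (char_poly (cplxmx A)) = char_poly (cplxmx A).
    rewrite char_poly_cplxmx -map_poly_comp; apply: eq_map_poly => a.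
    exact: conjc_real.
  rewrite big_map -[LHS]cE sE rmorph_prod; apply: eq_bigr => y _.
  by rewrite rmorphB/= map_polyX map_polyC.
rewrite /eigen_mult {1}sE' sE !mu_prod_XsubC count_map; apply: eq_count => y /=.
by rewrite (can_eq (@conjcK R)).
Qed.

Lemma eigen_mult_scale n (A : 'M[R]_n) (h : R) x : h != 0 ->
  (eigen_mult A x <= eigen_mult (h *: A) (h%:C * x)%R)%N.
Proof.
move=> h0; have hC := realc_neq0 h0.
have mon m (B : 'M[R[i]]_m) : char_poly B != 0.
  by rewrite monic_neq0// char_poly_monic.
pose B := cplxmx A.
have cE : cplxmx (h *: A) = h%:C *: B by rewrite /B /cplxmx map_mxZ.
have chE : char_poly B =
    (h%:C ^- n) *: (char_poly (h%:C *: B) \Po (h%:C *: 'X)).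
  have -> : char_poly (h%:C *: B) \Po (h%:C *: 'X) =
      \det (h%:C%:P *: char_poly_mx B).
    rewrite /char_poly -[LHS](det_map_mx (comp_poly (h%:C *: 'X))).
    congr (\det _); apply/matrixP => i j; rewrite !mxE.
    rewrite rmorphB/= comp_polyC rmorphMn/= comp_polyX.
    by rewrite mulrBr -mul_polyC mulrnAr rmorphM.
  by rewrite detZ -polyC_exp mul_polyC scalerA mulVf ?expf_neq0// scale1r.
rewrite /eigen_mult cE mup_geq//.
have : ('X - x%:P) ^+ mup x (char_poly B) %| char_poly B by rewrite -mup_geq.
rewrite {2}chE dvdpZr ?invr_eq0 ?expf_neq0// => /dvdpP[q qE].
apply/dvdpP.
exists ((q \Po (h%:C^-1 *: 'X)) * (h%:C ^- mup x (char_poly B))%:P).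
have -> : char_poly (h%:C *: B) =
    (char_poly (h%:C *: B) \Po (h%:C *: 'X)) \Po (h%:C^-1 *: 'X).
  rewrite -comp_polyA comp_polyZ comp_polyX scalerA mulfV// scale1r.
  by rewrite comp_polyXr.
rewrite qE rmorphM rmorphXn/= -mulrA; congr (_ * _).
rewrite rmorphB/= comp_polyX comp_polyC.
rewrite -exprVn polyC_exp -exprMn; congr (_ ^+ _).
by rewrite mulrBr mul_polyC -polyCM mulKf.
Qed.

Lemma horner_mxE n (A : 'M[R]_n.+1) (p : {poly R}) :
  horner_mx A p = \sum_(k < size p) p`_k *: A ^+ k.
Proof.
rewrite -[in LHS](coefK p) poly_def rmorph_sum; apply: eq_bigr => k _.
by rewrite /= horner_mxZ rmorphXn/= horner_mx_X.
Qed.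

Lemma horner_mx_scale n (A : 'M[R]_n.+1) (h : R) (p : {poly R}) :
  horner_mx (h *: A) p = horner_mx A (p \Po (h *: 'X)).
Proof.
elim/poly_ind: p => [|p c IH]; first by rewrite comp_poly0 !rmorph0.
rewrite comp_poly_MXaddC !(rmorphD, rmorphM)/= IH !horner_mx_C.
by rewrite horner_mx_X horner_mxZ horner_mx_X.
Qed.

(** If the jets agree up to the multiplicities of the eigenvalues, then the
    characteristic polynomial divides the difference of the polynomials, and
    the theorem of Cayley and Hamilton applies. *)
Lemma eq_horner_mx n (A : 'M[R]_n.+1) (p q : {poly R}) :
  (forall x, tangent (eigen_mult A x) (horner (toC p) : C -> C) (horner (toC q)) x) ->
  horner_mx A p = horner_mx A q.
Proof.
move=> pq; have [s sE] := char_poly_roots A.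
have : char_poly (cplxmx A) %| toC p - toC q.
  rewrite sE; apply: dvdp_prod_XsubC_count => x.
  apply/(@dvdp_XsubC_exp C) => j jx; rewrite derivnB hornerD hornerN; apply/eqP.
  rewrite subr_eq0 -!(@derive1n_horner C); apply/eqP.
  by apply: tangent_derive1n (pq x) _; rewrite /eigen_mult sE mu_prod_XsubC.
rewrite char_poly_cplxmx -rmorphB dvdp_map => /dvdpP[r rE].
apply/eqP; rewrite -subr_eq0 -rmorphB rE rmorphM/=.
by rewrite Cayley_Hamilton mulr0.
Qed.

Lemma interpolates_tangent n (A : 'M[R]_n) (f : C -> C) (p : {poly R}) x :
  interpolates f A p -> tangent (eigen_mult A x) f f x ->
  tangent (eigen_mult A x) f (horner (toC p)) x.
Proof.
move=> fp tf; apply: derive1n_tangent => //; first exact: tangent_horner.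
by move=> j jx; rewrite (@derive1n_horner C); apply/esym/fp.
Qed.

(** A complex interpolating polynomial P exists; as f commutes with conjugation
    and the spectrum of a real matrix is stable under it, the conjugate of P
    interpolates the same data, and so does their mean, which is real. *)
Lemma interpolates_exists n (A : 'M[R]_n) (f : C -> C) :
  (forall x, (0 < eigen_mult A x)%N -> tangent (eigen_mult A x) f f x) ->
  (forall x, f (conj x) = conj (f x)) ->
  exists p, interpolates f A p.
Proof.
move=> tf fc; have [s sE] := char_poly_roots A.
have [P PE] := @hermite_interpolation C s (fun x j => derive1n j f x).
have cP p x j : (map_poly conj p)^`(j).[x] = conj (p^`(j).[conj x]).
  by rewrite -{1}(conjcK x) derivn_map horner_map.
pose Q := 2^-1 *: (P + map_poly conj P).
have QE x j : (j < eigen_mult A x)%N -> Q^`(j).[x] = derive1n j f x.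
  move=> jx; rewrite /Q derivnZ derivnD !hornerE cP !PE.
  - rewrite (@derive1n_conj R (eigen_mult A x)) ?conjcK//.
    + by rewrite -mulr2n -[X in _ * X]mulr_natl mulKf ?pnatr_eq0.
    + exact: near_all.
    + by apply: tf; exact: leq_ltn_trans jx.
  - by move: jx; rewrite -eigen_mult_conj /eigen_mult sE mu_prod_XsubC.
  - by move: jx; rewrite /eigen_mult sE mu_prod_XsubC.
have Qreal : toC (map_poly (@complex.Re R) Q) = Q.
  apply/polyP => k; rewrite coef_map /= coef_map_id0//.
  rewrite RRe_real// /Q coefZ coefD coef_map/= addcJ.
  by rewrite mulKf ?pnatr_eq0// complex_real.
exists (map_poly (@complex.Re R) Q) => x j jx.
by rewrite Qreal QE.
Qed.

Lemma mxfunP n (A : 'M[R]_n.+1) (f : C -> C) :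
  (forall x, (0 < eigen_mult A x)%N -> tangent (eigen_mult A x) f f x) ->
  (forall x, f (conj x) = conj (f x)) ->
  exists2 p, mxfun f A = horner_mx A p &
    forall x, tangent (eigen_mult A x) f (horner (toC p)) x.
Proof.
move=> tf fc; have [p0 fp0] := interpolates_exists tf fc.
rewrite /mxfun; case: xgetP => [B _ [p fp ->]|].
  exists p; first by rewrite horner_mxE.
  move=> x; have [c0|c0] := posnP (eigen_mult A x); first by rewrite c0.
  by apply: interpolates_tangent => //; exact: tf.
by move=> /(_ (\sum_(k < size p0) p0`_k *: A ^+ k))/=[]; exists p0.
Qed.

Lemma horner_toC_scale (p : {poly R}) (h : R) :
  horner (toC (p \Po (h *: 'X))) = fun w : C => (toC p).[h%:C * w].
Proof.
apply/funext => w; rewrite map_comp_poly horner_comp map_polyZ/= map_polyX.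
by rewrite hornerZ hornerX.
Qed.

(** The matrix function of h A as a polynomial in A itself, so that matrix
    functions of A and of h A can be compared by eq_horner_mx. *)
Lemma mxfun_scaleP n (A : 'M[R]_n.+1) (h : R) (f : C -> C) : h != 0 ->
  (forall m x, tangent m f f x) -> (forall x, f (conj x) = conj (f x)) ->
  exists2 p, mxfun f (h *: A) = horner_mx A p &
    forall x, tangent (eigen_mult A x) (fun w => f (h%:C * w)) (horner (toC p)) x.
Proof.
move=> h0 tf fc; have [|p -> pf] := @mxfunP n (h *: A) f _ fc.
  by move=> x _.
exists (p \Po (h *: 'X)); first exact: horner_mx_scale.
move=> x; rewrite horner_toC_scale; apply: (@tangent_scale C _ f).
exact: tangent_leq (eigen_mult_scale A x h0) (pf _).
Qed.

(** Both identities hold between the scalar functions near each eigenvalue,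
    because zcoth h w - w = 2 / (h phi1 (h w)) there. *)
Lemma mxfun_step n (A : 'M[R]_n) (h : R) : h != 0 ->
  (forall x, eigenvalue (cplxmx A) x -> x != 0 ->
     csinh (h%:C * x / 2) != 0) ->
  let G := mxfun (zcoth h) A in
  (G - A) *m (h *: mxfun phi1 (h *: A)) = 2%:M /\
  G + A = (G - A) *m mxfun cexp (h *: A).
Proof.
case: n A => [|n] A h0 np.
  by split; rewrite [LHS]flatmx0 [RHS]flatmx0.
have pn x : (0 < eigen_mult A x)%N -> phi1 (h%:C * x) != 0.
  rewrite -XsubC_dvd ?monic_neq0 ?char_poly_monic// dvdp_XsubCl.
  rewrite -eigenvalue_root_char => ex; apply: phi1_neq0.
  by rewrite mulf_eq0 negb_or => /andP[_]; exact: np.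
have [p -> pE] := mxfun_scaleP A h0 (@tangent_cexp R) (@cexp_conj R).
have [q -> qE] := mxfun_scaleP A h0 (@tangent_phi1 R) (@phi1_conj R).
have [|g -> gE] := @mxfunP n A (zcoth h) _ (zcoth_conj h).
  by move=> x /pn; exact: tangent_zcoth.
have GB : horner_mx A g - A = horner_mx A (g - 'X).
  by rewrite rmorphB/= horner_mx_X.
have GD : horner_mx A g + A = horner_mx A (g + 'X).
  by rewrite rmorphD/= horner_mx_X.
have hC := realc_neq0 h0.
have XC : horner (toC 'X) = (fun w : C => w).
  by apply/funext => w; rewrite map_polyX hornerX.
have hornerB' (a b : {poly C}) : horner (a - b) = horner a + cst (-1) * horner b.
  by apply/funext => w; rewrite !hornerE mulN1r.
have hornerM' (a b : {poly C}) : horner (a * b) = horner a * horner b.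
  by apply/funext => w; rewrite hornerM.
have hornerD' (a b : {poly C}) : horner (a + b) = horner a + horner b.
  by apply/funext => w; rewrite hornerD.
have hornerC' (a : C) : horner a%:P = cst a.
  by apply/funext => w; rewrite hornerC.
have tGB x : tangent (eigen_mult A x) ((zcoth h : C -> C) + cst (-1) * (fun w => w))
    (horner (toC g) + cst (-1) * (fun w => w)) x.
  exact: tangentD (gE x) (tangentM (tangent_cst _ _ _) (tangent_id _ _)).
split.
- rewrite GB -horner_mxZ -[_ *m _]rmorphM -(horner_mx_C A).
  apply: eq_horner_mx => x.
  have [c0|c0] := posnP (eigen_mult A x); first by rewrite c0.
  rewrite rmorphM rmorphB -mul_polyC rmorphM/= !map_polyC.
  rewrite hornerM' hornerB' hornerM' !hornerC' XC; apply: tangent_sym.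
  have := tangentM (tGB x) (tangentM (tangent_cst _ h%:C x) (qE x)).
  apply: tangent_near; apply: filterS (near_phi1_neq0 (pn x c0)) => w w0.
  rewrite !fctE (zcothE h0 w0) mulN1r addrAC subrr add0r divfK ?mulf_neq0//.
  exact/esym/(rmorph_nat (real_complex R) 2).
- rewrite GB GD -[_ *m _]rmorphM.
  apply: eq_horner_mx => x.
  have [c0|c0] := posnP (eigen_mult A x); first by rewrite c0.
  rewrite rmorphM rmorphB rmorphD/= hornerM' hornerB' hornerD' XC.
  apply: tangent_trans (tangent_sym (tangentD (gE x) (tangent_id _ x))) _.
  apply: tangent_near (tangentM (tGB x) (pE x)).
  apply: filterS (near_phi1_neq0 (pn x c0)) => w w0.
  rewrite !fctE (zcothE h0 w0) mulN1r addrAC subrr add0r.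
  have -> : cexp (h%:C * w) = h%:C * w * phi1 (h%:C * w) + 1.
    by rewrite mul_phi1 subrK.
  by field; rewrite hC w0.
Qed.

End MatrixFunction.

(** * Differentials by epsilon estimates *)

Section Differentials.
Variables (K : numFieldType) (U V : normedModType K).

Lemma is_diff_eps (f : U -> V) (L : {linear U -> V}) x :
  continuous L ->
  (forall e : K, 0 < e ->
     \forall h \near (0 : U), `|f (h + x) - f x - L h| <= e * `|h|) ->
  is_diff x f L.
Proof.
move=> Lc fL.
have fE : f \o shift x = cst (f x) + L +o_ 0 id.
  apply/eqaddoP => e e0; apply: filterS (fL e e0) => h /=.
  rewrite -![(_ + _ : _ -> _) _]/(_ + _) -![(- _ : _ -> _) _]/(- _) /cst /=.
  by rewrite opprD addrA.
have dE := diff_unique Lc fE.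
by apply: DiffDef => //; apply/diff_locallyP; rewrite dE; split.
Qed.

Lemma diff_eps (f : U -> V) x (e : K) : differentiable f x -> 0 < e ->
  \forall h \near (0 : U), `|f (h + x) - f x - 'd f x h| <= e * `|h|.
Proof.
move=> /diff_locallyP[_ /eqaddoP/(_ e) fE] /fE; apply: filterS => h /=.
rewrite -![(_ + _ : _ -> _) _]/(_ + _) -![(- _ : _ -> _) _]/(- _) /cst /=.
by rewrite opprD addrA.
Qed.

End Differentials.

Section MatrixNorm.
Variable R : realType.

Lemma norm_mx_entry m n (M : 'M[R]_(m, n)) i j : `|M i j| <= `|M|.
Proof.
rewrite [leRHS]/Num.Def.normr/= mx_normrE.
exact: (le_bigmax _ (fun ij : 'I_m * 'I_n => `|M ij.1 ij.2|) (i, j)).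
Qed.

Lemma norm_mx_le m n (M : 'M[R]_(m, n)) (e : R) : 0 <= e ->
  (forall i j, `|M i j| <= e) -> `|M| <= e.
Proof.
move=> e0 Me; rewrite [leLHS]/Num.Def.normr/= mx_normrE.
by apply: bigmax_le => // -[i j] _ /=.
Qed.

Lemma norm_mulmx_bound m n (A : 'M[R]_(m, n)) :
  exists2 k, 0 <= k & forall v : 'cV[R]_n, `|A *m v| <= k * `|v|.
Proof.
exists (\sum_i \sum_j `|A i j|).
  by apply: sumr_ge0 => i _; apply: sumr_ge0.
move=> v; apply: norm_mx_le => [|i j].
  by rewrite mulr_ge0//; apply: sumr_ge0 => i _; apply: sumr_ge0.
rewrite mxE (le_trans (ler_norm_sum _ _ _))//.
apply: (@le_trans _ _ (\sum_k `|A i k| * `|v|)).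
  by apply: ler_sum => k _; rewrite normrM ler_wpM2l// norm_mx_entry.
rewrite -mulr_suml ler_wpM2r//.
by rewrite (bigD1 i)//= lerDl; apply: sumr_ge0 => k _; apply: sumr_ge0.
Qed.

Definition mulmx_pair m n (A B : 'M[R]_(m, n)) (v : 'cV[R]_n * 'cV[R]_n) :
  'cV[R]_m := A *m v.1 + B *m v.2.

Lemma mulmx_pair_is_linear m n (A B : 'M[R]_(m, n)) : linear (mulmx_pair A B).
Proof.
move=> a u v; rewrite /mulmx_pair /= !mulmxDr -!scalemxAr scalerDr.
by rewrite addrACA.
Qed.

HB.instance Definition _ m n (A B : 'M[R]_(m, n)) :=
  GRing.isLinear.Build R _ _ _ (mulmx_pair A B) (mulmx_pair_is_linear A B).

Lemma mulmx_pair_continuous m n (A B : 'M[R]_(m, n)) :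
  continuous (mulmx_pair A B).
Proof.
have [a a0 aA] := norm_mulmx_bound A.
have [b b0 bB] := norm_mulmx_bound B.
apply/linear_bounded_continuous; apply/linear_boundedP.
exists (a + b); split; first exact: num_real.
move=> r /ltW rab [v w]; apply: (le_trans (ler_normD _ _)).
apply: (@le_trans _ _ ((a + b) * `|(v, w)|)); last by rewrite ler_wpM2r.
rewrite mulrDl; apply: lerD.
  by apply: (le_trans (aA _)); rewrite ler_wpM2l// prod_normE le_max lexx.
by apply: (le_trans (bB _)); rewrite ler_wpM2l// prod_normE le_max lexx orbT.
Qed.

End MatrixNorm.

(** * First-order behaviour of the discrete gradient *)

Section DiscreteGradient.
Variables (R : realType) (n : nat).
Implicit Types (H f : 'cV[R]_n -> R) (y a v : 'cV[R]_n).

Lemma is_derive_line f a v (s : R) : differentiable f (a + s *: v) ->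
  is_derive s 1 (fun t => f (a + t *: v)) ('D_v f (a + s *: v)).
Proof.
move=> df; pose g t := f (a + t *: v).
have E : (fun h : R => h^-1 *: ((g \o shift s) (h *: 1) - g s))
   = (fun h : R => h^-1 *: ((f \o shift (a + s *: v)) (h *: v) - f (a + s *: v))).
  apply/funext => h /=; congr (_ *: (f _ - _)).
  by rewrite [h%:A]mulr1 scalerDl addrCA.
split; first by rewrite /derivable E; exact: diff_derivable.
by rewrite /derive E.
Qed.

(** The secant slope of the quadratic polynomial with derivative c + k s is
    c + k (s0 + s1) / 2; subtracting it reduces the claim to the mean value
    theorem. *)
Lemma secant_affine_error (q q' : R -> R) (c k s0 s1 : R) : s0 != s1 ->
  (forall s : R, is_derive s 1 q (q' s)) ->
  exists2 s, Num.min s0 s1 <= s <= Num.max s0 s1 &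
    (q s1 - q s0) / (s1 - s0) - (c + k * ((s0 + s1) / 2)) = q' s - (c + k * s).
Proof.
move=> s01 dq; wlog lt01 : s0 s1 s01 / s0 < s1 => [W|].
  have /orP[lt|lt] := lt_total s01; first exact: W.
  have [|s sP E] := W s1 s0 _ lt; first by rewrite eq_sym.
  exists s; first by rewrite minC maxC.
  rewrite -E [s0 + s1]addrC; congr (_ - _).
  by rewrite -[q s1 - q s0]opprB -[s1 - s0]opprB invrN mulrNN.
pose psi t := q t - (c * t + k / 2 * t ^+ 2).
have dpsi (t : R) : is_derive t 1 psi (q' t - (c + k * t)).
  have d1 := is_derive_cM c (is_derive_id t (1 : R)).
  have d2 := is_derive_cM (k / 2) (is_derive_exprn 2 t).
  apply: (is_derive_eq (is_deriveB (dq t) (is_deriveD d1 d2))).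
  by rewrite /= expr1; field.
have psic : {within `[s0, s1], continuous psi}.
  by apply: derivable_within_continuous => t _; case: (dpsi t).
have [s sP E] := MVT lt01 (fun t _ => dpsi t) psic.
exists s.
  move: sP; rewrite in_itv/= (min_idPl (ltW lt01)) (max_idPr (ltW lt01)).
  by move=> /andP[/ltW-> /ltW->].
have d0 : s1 - s0 != 0 by rewrite subr_eq0 eq_sym.
apply: (mulIf d0); rewrite -E mulrBl divfK// /psi.
by field.
Qed.

(** The line that carries the edge from stair y0 y1 j to stair y0 y1 j.+1,
    parametrized by its j-th coordinate. *)
Definition stair_path y0 y1 (j : 'I_n) (s : R) : 'cV[R]_n :=
  stair y0 y1 j - y0 j 0 *: basis_vec R j + s *: basis_vec R j.

Lemma stair_pathE y0 y1 j s i : stair_path y0 y1 j s i 0 =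
  if (i < j)%N then y1 i 0 else if i == j then s else y0 i 0.
Proof.
rewrite !mxE eqxx andbT; case: ltngtP => [lt|lt|/val_inj->].
- by rewrite (negPf (_ : i != j)) ?mulr0 ?subr0 ?addr0// neq_ltn lt.
- by rewrite (negPf (_ : i != j)) ?mulr0 ?subr0 ?addr0// neq_ltn lt orbT.
- by rewrite eqxx !mulr1 subrr add0r.
Qed.

Lemma stair_path0 y0 y1 j : stair_path y0 y1 j (y0 j 0) = stair y0 y1 j.
Proof. by rewrite /stair_path subrK. Qed.

Lemma stair_path1 y0 y1 j : stair_path y0 y1 j (y1 j 0) = stair y0 y1 j.+1.
Proof.
apply/matrixP => i k; rewrite ord1 stair_pathE mxE ltnS.
case: ltngtP => // [lt|/val_inj->]; last by rewrite eqxx.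
by rewrite (negPf (_ : i != j))// neq_ltn lt orbT.
Qed.

Lemma stair_id y k : stair y y k = y.
Proof. by apply/matrixP => i j; rewrite mxE ord1; case: ifP. Qed.

Lemma discrete_grad_id H y : discrete_grad H y y = grad H y.
Proof. by apply/matrixP => i j; rewrite !mxE eqxx stair_id. Qed.

Lemma stair_path_near y0 y1 y j s :
  Num.min (y0 j 0) (y1 j 0) <= s <= Num.max (y0 j 0) (y1 j 0) ->
  `|stair_path y0 y1 j s - y| <= `|(y0 - y, y1 - y)|.
Proof.
move=> sP.
have N0 := @norm_mx_entry R _ _ (y0 - y); have N1 := @norm_mx_entry R _ _ (y1 - y).
have [N0' N1'] : `|y0 - y| <= `|(y0 - y, y1 - y)| /\
    `|y1 - y| <= `|(y0 - y, y1 - y)|.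
  by rewrite !prod_normE/= !le_max !lexx orbT.
apply: norm_mx_le => // i k; rewrite ord1 mxE [(- y) i 0]mxE stair_pathE.
have := N0 i 0; have := N1 i 0; rewrite !mxE.
case: ltngtP => [lt|lt|/val_inj ij] n1 n0.
- exact: le_trans N1'.
- by rewrite (negPf (_ : i != j)) ?neq_ltn ?lt ?orbT//; exact: le_trans N0'.
rewrite -ij in sP; rewrite ij eqxx -ij.
have {n0} := le_trans n0 N0'; have {n1} := le_trans n1 N1'.
move: sP; rewrite !ler_norml ge_min le_max; move: (y0 i 0) (y1 i 0) => u w.
by move=> /andP[/orP[] h1 /orP[] h2] /andP[h3 h4] /andP[h5 h6]; lra.
Qed.

Lemma partial_line H y0 y1 j (s : R) : (forall y, differentiable H y) ->
  is_derive s 1 (fun t => H (stair_path y0 y1 j t))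
    (partial j H (stair_path y0 y1 j s)).
Proof. by move=> dH; exact: is_derive_line. Qed.

(** The j-th component of the discrete gradient differs from the mean of the
    affine approximation of dH/dy^j over the two ends of the j-th edge by the
    error of that approximation at a single point of the edge, which is
    o(x - y) as dH/dy^j is differentiable at y. *)
Lemma discrete_grad_mean H y0 y1 y (j : 'I_n) :
  (forall x, differentiable H x) ->
  exists2 x, `|x - y| <= `|(y0 - y, y1 - y)| &
    discrete_grad H y0 y1 j 0 - partial j H y
      - 'd (partial j H) y (2^-1 *: (stair y0 y1 j + stair y0 y1 j.+1) - y)
    = partial j H x - partial j H y - 'd (partial j H) y (x - y).
Proof.
move=> dH; set d := 'd _ y.
have [E|ne] := eqVneq (y1 j 0) (y0 j 0).
  exists (stair_path y0 y1 j (y0 j 0)).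
    by apply: stair_path_near; rewrite ge_min le_max lexx.
  have S : stair y0 y1 j.+1 = stair y0 y1 j by rewrite -stair_path1 E stair_path0.
  rewrite mxE E eqxx stair_path0 S -mulr2n -[stair _ _ _ *+ 2]scaler_nat.
  by rewrite scalerA mulVf ?pnatr_eq0// scale1r.
pose a := stair y0 y1 j - y0 j 0 *: basis_vec R j.
pose e : 'cV[R]_n := basis_vec R j.
have [|s sP sE] := @secant_affine_error (fun t => H (stair_path y0 y1 j t))
  (fun t => partial j H (stair_path y0 y1 j t)) (partial j H y + d (a - y)) (d e)
  (y0 j 0) (y1 j 0) _ (fun t => partial_line y0 y1 j t dH).
  by rewrite eq_sym.
exists (stair_path y0 y1 j s); first exact: stair_path_near.
have dpath t : d (a + t *: e - y) = d (a - y) + d e * t.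
  by rewrite addrAC linearD linearZ/= [_ *: _]mulrC.
rewrite (dpath s : d (stair_path y0 y1 j s - y) = _) -stair_path0 -stair_path1.
have -> : 2^-1 *: (stair_path y0 y1 j (y0 j 0) + stair_path y0 y1 j (y1 j 0)) =
    a + ((y0 j 0 + y1 j 0) / 2) *: e.
  rewrite /stair_path -/a -/e addrACA -mulr2n -scalerDl scalerDr.
  rewrite -[a *+ 2]scaler_nat !scalerA mulVf ?pnatr_eq0// scale1r.
  by rewrite [_^-1 * _]mulrC.
rewrite dpath mxE (negPf ne) -stair_path0 -stair_path1.
move: sE; set A := (_ / _) => sE.
have -> : A - partial j H y - (d (a - y) + d e * ((y0 j 0 + y1 j 0) / 2)) =
    A - (partial j H y + d (a - y) + d e * ((y0 j 0 + y1 j 0) / 2)).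
  by rewrite !opprD !addrA.
by rewrite sE !opprD !addrA.
Qed.

Lemma diff_partialE f y v : differentiable f y ->
  'd f y v = \sum_k partial k f y * v k 0.
Proof.
move=> df; have {1}-> : v = \sum_k v k 0 *: basis_vec R k.
  apply/matrixP => i j; rewrite ord1 summxE (bigD1 i)//= big1 => [|k ki].
    by rewrite !mxE !eqxx mulr1 addr0.
  by rewrite !mxE eqxx eq_sym (negPf ki) mulr0.
rewrite linear_sum; apply: eq_bigr => k _.
by rewrite linearZ/= /partial deriveE// mulrC.
Qed.

(** The partial derivatives of the discrete gradient in its two arguments, at a
    diagonal point: the strict upper (resp. lower) triangle of the Hessian plus
    half of its diagonal. *)
Definition hess_left H y := 2^-1 *: (hess H y - skew_hess H y).
Definition hess_right H y := 2^-1 *: (hess H y + skew_hess H y).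

Lemma diff_stair_mid H y0 y1 y (j : 'I_n) : differentiable (partial j H) y ->
  'd (partial j H) y (2^-1 *: (stair y0 y1 j + stair y0 y1 j.+1) - y) =
  (hess_left H y *m (y0 - y) + hess_right H y *m (y1 - y)) j 0.
Proof.
move=> dH; rewrite diff_partialE// !mxE -big_split/=; apply: eq_bigr => k _.
by rewrite !mxE ltnS; case: (ltngtP k j) => _; field.
Qed.

Lemma discrete_grad_eps H y (e : R) : 0 < e ->
  (forall x, differentiable H x) -> (forall j, differentiable (partial j H) y) ->
  \forall h \near (0 : 'cV[R]_n * 'cV[R]_n),
    `|discrete_grad H (h.1 + y) (h.2 + y) - grad H y
      - mulmx_pair (hess_left H y) (hess_right H y) h| <= e * `|h|.
Proof.
move=> e0 dH dpH.
pose P j v :=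
  `|partial j H (v + y) - partial j H y - 'd (partial j H) y v| <= e * `|v|.
have Pj j : \forall v \near (0 : 'cV[R]_n), P j v by exact: diff_eps.
have [r /= r0 rP] := nbhs_norm0P.1 (filter_forall _ Pj).
apply/nbhs_norm0P; exists r => //= h hr.
apply: norm_mx_le => [|j k]; first by rewrite mulr_ge0// ltW.
rewrite ord1.
have [x xh xE] := discrete_grad_mean (h.1 + y) (h.2 + y) y j dH.
rewrite !addrK -surjective_pairing in xh.
rewrite 2!mxE [(- grad H y) j 0]mxE [grad H y j 0]mxE.
rewrite [(- mulmx_pair _ _ _) j 0]mxE.
rewrite diff_stair_mid// !addrK in xE; rewrite xE.
apply: (@le_trans _ _ (e * `|x - y|)); last by rewrite ler_wpM2l// ltW.
by have := rP (x - y) (le_lt_trans xh hr) j; rewrite /P subrK.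
Qed.

Lemma is_diff_dg_residual (M : 'M[R]_n) H y :
  (forall x, differentiable H x) -> (forall j, differentiable (partial j H) y) ->
  is_diff (y, y) (fun z => z.2 - z.1 - M *m discrete_grad H z.1 z.2)
    (mulmx_pair (- 1%:M - M *m hess_left H y) (1%:M - M *m hess_right H y)).
Proof.
move=> dH dpH; apply: is_diff_eps; first exact: mulmx_pair_continuous.
move=> e e0; have [k k0 Mk] := norm_mulmx_bound M.
have k1 : 0 < k + 1 by rewrite ltr_wpDl.
have ek : 0 < e / (k + 1) by rewrite divr_gt0.
apply: filterS (discrete_grad_eps ek dH dpH) => h hE /=.
set g := discrete_grad H _ _ in hE *.
rewrite discrete_grad_id.
have -> : h.2 + y - (h.1 + y) - M *m g - (y - y - M *m grad H y)
    - mulmx_pair (- 1%:M - M *m hess_left H y) (1%:M - M *m hess_right H y) h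
  = - (M *m (g - grad H y - mulmx_pair (hess_left H y) (hess_right H y) h)).
  rewrite /mulmx_pair !(mulmxBl, mulmxBr, mulmxDr, mulNmx, mul1mx) !mulmxA.
  rewrite subrr sub0r opprK.
  move: (M *m g) (M *m grad H y) (M *m _ *m h.1) (M *m _ *m h.2) => a b c d.
  rewrite !opprD !opprK.
  by apply/matrixP => i j; rewrite !mxE; ring.
rewrite normrN; apply: (le_trans (Mk _)).
apply: (@le_trans _ _ (k * (e / (k + 1) * `|h|))); first by rewrite ler_wpM2l.
rewrite mulrA ler_wpM2r// mulrCA ler_piMr ?(ltW e0)//.
by rewrite ler_pdivrMr// mul1r lerDl.
Qed.

End DiscreteGradient.

(** * Local exactness *)

Unset Implicit Arguments.

Theorem proposition4p11 (R : realType) (m : nat) (H : 'cV[R]_(m + m) -> R)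
    (ybar : 'cV[R]_(m + m)) (h : R) :
  smooth H -> 0 < h -> theta_defined H h ybar ->
  locally_exact (hamF H ybar) (hamDF H ybar) h
    (dg_residual (theta H h ybar) H) ybar.
Proof.
move=> smH h0 [np thU].
have dH x : differentiable H x by exact: (smH [::] x).
have dpH j : differentiable (partial j H) ybar by exact: (smH [:: j] ybar).
set th := theta H h ybar; set S := symplmx R m.
have [dres dresE] := is_diff_dg_residual (th *m S) dH dpH.
split=> // nu0 nu1; rewrite dresE /=.
set A := hamDF H ybar; set F := hamF H ybar.
have [GP GE] := mxfun_step (lt0r_neq0 h0) np.
set G := mxfun (zcoth h) A in GP GE *.
set Phi := mxfun (@phi1 R) _ in GP *; set E := mxfun (@cexp R) _ in GE *.
pose D := theta_den H h ybar.
have Dth : D *m th = 2%:M.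
  by rewrite /th /theta -scalemxAr mulmxV// scalemx1.
pose rhs := E *m nu0 + h *: (Phi *m F).
(* in the scheme multiplied by 2 theta^-1 the terms in skew_hess cancel *)
have step : D *m (dg_residual th H (ybar, ybar) +
    mulmx_pair (- 1%:M - th *m S *m hess_left H ybar)
      (1%:M - th *m S *m hess_right H ybar) (nu0, nu1)) = (G - A) *m (nu1 - rhs).
  have -> : (G - A) *m (nu1 - rhs) = (G - A) *m nu1 - (G + A) *m nu0 - 2 *: F.
    rewrite mulmxBr /rhs mulmxDr mulmxA -GE opprD addrA; congr (_ - _).
    by rewrite scalemxAl mulmxA GP mul_scalar_mx.
  rewrite /dg_residual /= subrr sub0r discrete_grad_id /mulmx_pair /=.
  have DX (X : 'cV[R]_(m + m)) : D *m (th *m X) = 2 *: X.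
    by rewrite mulmxA Dth mul_scalar_mx.
  rewrite mulmxDr mulmxN -!mulmxA DX -/F mulmxDr !mulmxBl mulNmx !mul1mx.
  rewrite -!mulmxA !mulmxBr mulmxN !DX.
  have DE : D = S *m skew_hess H ybar + G by [].
  have AE : A = S *m hess H ybar by [].
  rewrite /hess_left /hess_right -!scalemxAl -!scalemxAr !scalerA.
  rewrite mulfV ?pnatr_eq0// !scale1r.
  rewrite DE AE /F /hamF !mulmxBl !mulmxDl !mulmxBr !mulmxDr -/S !mulmxA.
  move: (G *m _) (G *m _) (S *m hess _ _ *m _) (S *m hess _ _ *m _)
    (S *m skew_hess _ _ *m _) (S *m skew_hess _ _ *m _) => a b c d u v.
  by apply/matrixP => i j; rewrite !mxE; ring.
have DU : D \in unitmx by [].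
have GU : (G - A) \in unitmx.
  suff : (G - A) *m (2^-1 *: (h *: Phi)) = 1%:M by case/mulmx1_unit.
  by rewrite -scalemxAr GP scale_scalar_mx mulVf// pnatr_eq0.
split=> [res0|nuE].
  move: step; rewrite res0 mulmx0 => /esym/(congr1 (mulmx (invmx (G - A)))).
  by rewrite mulKmx// mulmx0 => /eqP; rewrite subr_eq0 => /eqP.
move: step; rewrite nuE subrr mulmx0 => /(congr1 (mulmx (invmx D))).
by rewrite mulKmx// mulmx0.
Qed.
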